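(* Let $d \geq 1$. For every integer $k \geq 1$ and every real $\varepsilon > 0$, there is a $\tau > 0$ such that for every injective map $\varphi \colon \mathbb{Z}^d \to \mathbb{R}^d$ with $\varphi(0) = 0$ and $\sup_{a \in \mathbb{Z}^d} \|a - \varphi(a)\| < \tau$, we have $|\beta_k(u) - \alpha_k(u)| < \varepsilon$ for every direction $u \in \mathbb{S}^{d-1}$, where $\alpha_k(u)$ and $\beta_k(u)$ are the distances from $0$, in direction $u$, of the boundaries of $\mathrm{dom}_k(0,\mathbb{Z}^d)$ and $\mathrm{dom}_k(0,\varphi(\mathbb{Z}^d))$, respectively.
   Context: For a locally finite set $A \subseteq \mathbb{R}^d$ with $0 \in A$ and an integer $k \geq 1$, $\mathrm{dom}_k(0,A)$ is the set of points $x \in \mathbb{R}^d$ for which fewer than $k$ points $a \in A \setminus \{0\}$ satisfy $\|x-a\| < \|x\|$ (this is the union of the first $k$ Brillouin zones of $0$ in $A$). For $u \in \mathbb{S}^{d-1}$, $\alpha_k(u)$ is the unique $\lambda \geq 0$ with $\lambda u \in \partial\, \mathrm{dom}_k(0,\mathbb{Z}^d)$, and, with $P = \varphi(\mathbb{Z}^d)$, $\beta_k(u)$ is the unique $\lambda \geq 0$ with $\lambda u \in \partial\, \mathrm{dom}_k(0,P)$. *)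

(* Defs.v *)
From HB Require Import structures.
From mathcomp Require Import all_boot all_order all_algebra.
From mathcomp Require Import all_classical all_reals all_analysis.

Set Implicit Arguments.
Unset Strict Implicit.
Unset Printing Implicit Defensive.

Import Order.TTheory GRing.Theory Num.Theory.
Import numFieldNormedType.Exports.

Local Open Scope classical_set_scope.
Local Open Scope card_scope.
Local Open Scope ring_scope.

(* The library norm on 'rV[R]_d is the max norm, hence this definition; the
   library topology on 'rV[R]_d, used in [boundary], is the Euclidean one. *)
Definition enorm (R : realType) (d : nat) (x : 'rV[R]_d) : R :=
  Num.sqrt (\sum_(i < d) x 0 i ^+ 2).

Definition unit_sphere (R : realType) (d : nat) : set 'rV[R]_d :=
  [set u | enorm u = 1].
Arguments unit_sphere : clear implicits.

Definition boundary (T : topologicalType) (A : set T) : set T :=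
  closure A `\` interior A.

Definition int_vec (R : realType) (d : nat) (a : 'rV[int]_d) : 'rV[R]_d :=
  map_mx intr a.

(* "Fewer than k points" is meant in the strict sense: the set of these points
   is finite, of cardinality n < k. *)
Definition dom (R : realType) (d k : nat) (A : set 'rV[R]_d) : set 'rV[R]_d :=
  [set x | exists2 n, (n < k)%N &
     [set a | (A `\ 0) a /\ enorm (x - a) < enorm x] #= `I_n].

(* The unique l >= 0 with l u on the boundary of dom_k(0, A). It exists and is
   unique for k >= 1 and u on the sphere as soon as A contains 0, is locally
   finite, and meets every ball of some fixed radius. This is the case of Z^d,
   and of phi(Z^d) whenever |a - phi(a)| is bounded and phi(0) = 0. *)
Definition bd_dist (R : realType) (d k : nat) (A : set 'rV[R]_d)
    (u : 'rV[R]_d) : R :=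
  get [set l : R | 0 <= l /\ boundary (dom k A) (l *: u)].

Definition alpha (R : realType) (d k : nat) (u : 'rV[R]_d) : R :=
  bd_dist k (range (@int_vec R d)) u.

Definition beta (R : realType) (d k : nat) (phi : 'rV[int]_d -> 'rV[R]_d)
    (u : 'rV[R]_d) : R :=
  bd_dist k (range phi) u.

(* Main.v *)
Require Import Defs.
From mathcomp Require Import all_boot all_order all_algebra.
From mathcomp Require Import all_classical all_reals all_analysis.
From mathcomp Require Import ring lra.
Set Implicit Arguments.
Unset Strict Implicit.
Unset Printing Implicit Defensive.
Import Order.TTheory GRing.Theory Num.Theory.
Import numFieldNormedType.Exports.
Local Open Scope classical_set_scope.
Local Open Scope card_scope.
Local Open Scope ring_scope.

(** Write the condition that [a] is closer to [x] than [0] is as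
    [<a, a> < 2 <x, a>]. For [x = l u] on the ray of direction [u] it reads
    [<a, a> < 2 l <u, a>], so that it persists when [l] grows, and persists with
    a definite margin when [l] grows by [eps]. The margin absorbs small
    displacements of [x] and of [a], uniformly in [u], as long as the initial
    [l] is bounded and [a] stays away from [0] ([closer_perturb]). Counting
    points by their lattice index, it follows that if a point near [m u] lies
    outside [dom_k] of one of the two sets and [m + eps <= l], then all points
    near [l u] lie outside [dom_k] of the other ([dom_perturb]).

    A boundary point [l u] of [dom_k] has points of [dom_k] and points of its
    complement arbitrarily close to it. Applied to such points,
    [dom_perturb] excludes both [alpha + eps <= beta] and
    [beta + eps <= alpha].

    Two facts remain. The distances [alpha] are bounded uniformly in [u]: some
    coordinate of [u] is at least [1/d] in absolute value, and [k] lattice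
    points on that axis keep [k d u] out of [dom_k] ([card_closer_lattice]).
    Boundary points exist on each ray: by [dom_perturb] again, both sets have
    [dom_k] bounded on the ray, and the supremum of the distances in [dom_k] is
    a boundary distance ([boundary_on_ray]). *)

(** * The Euclidean inner product *)

Definition dot (R : realType) (d : nat) (x y : 'rV[R]_d) : R :=
  \sum_(i < d) x 0 i * y 0 i.

Lemma dotC (R : realType) (d : nat) (x y : 'rV[R]_d) : dot x y = dot y x.
Proof. by apply: eq_bigr => i _; rewrite mulrC. Qed.

Lemma dotDl (R : realType) (d : nat) (x y z : 'rV[R]_d) :
  dot (x + y) z = dot x z + dot y z.
Proof. by rewrite -big_split; apply: eq_bigr => i _; rewrite mxE mulrDl. Qed.

Lemma dotZl (R : realType) (d : nat) (c : R) (x z : 'rV[R]_d) :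
  dot (c *: x) z = c * dot x z.
Proof. by rewrite mulr_sumr; apply: eq_bigr => i _; rewrite mxE mulrA. Qed.

Lemma dotNl (R : realType) (d : nat) (x z : 'rV[R]_d) :
  dot (- x) z = - dot x z.
Proof. by rewrite -scaleN1r dotZl mulN1r. Qed.

Lemma dotBl (R : realType) (d : nat) (x y z : 'rV[R]_d) :
  dot (x - y) z = dot x z - dot y z.
Proof. by rewrite dotDl dotNl. Qed.

Lemma dotDr (R : realType) (d : nat) (x y z : 'rV[R]_d) :
  dot z (x + y) = dot z x + dot z y.
Proof. by rewrite dotC dotDl !(dotC z). Qed.

Lemma dotZr (R : realType) (d : nat) (c : R) (x z : 'rV[R]_d) :
  dot z (c *: x) = c * dot z x.
Proof. by rewrite dotC dotZl (dotC z). Qed.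

Lemma dotBr (R : realType) (d : nat) (x y z : 'rV[R]_d) :
  dot z (x - y) = dot z x - dot z y.
Proof. by rewrite dotC dotBl !(dotC z). Qed.

Lemma dot_ge0 (R : realType) (d : nat) (x : 'rV[R]_d) : 0 <= dot x x.
Proof. by apply: sumr_ge0 => i _; rewrite -expr2 sqr_ge0. Qed.

Lemma enormE (R : realType) (d : nat) (x : 'rV[R]_d) :
  enorm x = Num.sqrt (dot x x).
Proof. by congr Num.sqrt; apply: eq_bigr => i _; rewrite expr2. Qed.

Lemma enorm_ge0 (R : realType) (d : nat) (x : 'rV[R]_d) : 0 <= enorm x.
Proof. exact: sqrtr_ge0. Qed.

Lemma sqr_enorm (R : realType) (d : nat) (x : 'rV[R]_d) :
  enorm x ^+ 2 = dot x x.
Proof. by rewrite enormE sqr_sqrtr // dot_ge0. Qed.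

Lemma enorm_eq0 (R : realType) (d : nat) (x : 'rV[R]_d) :
  enorm x = 0 -> x = 0.
Proof.
move=> x0; have /eqP : dot x x = 0 by rewrite -sqr_enorm x0 expr0n.
rewrite psumr_eq0; last by move=> i _; rewrite -expr2 sqr_ge0.
move=> /allP xi0; apply/rowP => i; rewrite mxE; apply/eqP.
by have := xi0 i (mem_index_enum i); rewrite -expr2 sqrf_eq0.
Qed.

Lemma enorm0 (R : realType) (d : nat) : enorm (0 : 'rV[R]_d) = 0.
Proof. by rewrite enormE -(scale0r 0) dotZl mul0r sqrtr0. Qed.

Lemma enormN (R : realType) (d : nat) (x : 'rV[R]_d) : enorm (- x) = enorm x.
Proof. by rewrite !enormE dotNl dotC dotNl opprK. Qed.

Lemma enormZ (R : realType) (d : nat) (c : R) (x : 'rV[R]_d) :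
  0 <= c -> enorm (c *: x) = c * enorm x.
Proof.
by move=> c0; rewrite !enormE dotZl dotZr mulrA -expr2 sqrtrM ?sqr_ge0 //
  sqrtr_sqr ger0_norm.
Qed.

(** For nonzero [x] and [y] this is the nonnegativity of the squared norm of
    [|y| x - |x| y]. *)
Lemma dot_le (R : realType) (d : nat) (x y : 'rV[R]_d) :
  dot x y <= enorm x * enorm y.
Proof.
have [x0|x0] := eqVneq (enorm x) 0.
  by rewrite x0 (enorm_eq0 x0) -(scale0r 0) dotZl !mul0r.
have [y0|y0] := eqVneq (enorm y) 0.
  by rewrite y0 (enorm_eq0 y0) -(scale0r 0) dotZr mulr0 mul0r.
have xy : 0 < enorm x * enorm y.
  by rewrite mulr_gt0 // lt_neqAle eq_sym ?x0 ?y0 enorm_ge0.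
have := dot_ge0 (enorm y *: x - enorm x *: y).
rewrite dotBl !dotBr !dotZl !dotZr (dotC y x) -!sqr_enorm => H.
rewrite -(ler_pM2l xy) -subr_ge0 -(pmulr_rge0 _ (ltr0Sn R 1)).
by apply: le_trans H _; rewrite le_eqVlt; apply/orP; left; apply/eqP; ring.
Qed.

Lemma dot_ge (R : realType) (d : nat) (x y : 'rV[R]_d) :
  - (enorm x * enorm y) <= dot x y.
Proof. by rewrite lerNl -dotNl -(enormN x); exact: dot_le. Qed.

Lemma ler_enormD (R : realType) (d : nat) (x y : 'rV[R]_d) :
  enorm (x + y) <= enorm x + enorm y.
Proof.
rewrite -ler_sqr ?nnegrE ?addr_ge0 ?enorm_ge0 //.
rewrite sqr_enorm dotDl !dotDr -!sqr_enorm (dotC y x).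
by have := dot_le x y; nra.
Qed.

(** The bisector of [0] and [a] in linear form: this is what makes the
    condition defining the Brillouin zones affine along each ray. *)
Lemma closer_dot (R : realType) (d : nat) (x a : 'rV[R]_d) :
  (enorm (x - a) < enorm x) = (dot a a < 2 * dot x a).
Proof.
rewrite -ltr_sqr ?nnegrE ?enorm_ge0 // !sqr_enorm dotBl !dotBr (dotC a x).
by apply/idP/idP => H; lra.
Qed.

(** The norm in which distances are measured here need not be the one that
    defines the topology; they are linked through continuity. *)
Lemma enorm_dist_continuous (R : realType) (d : nat) (y : 'rV[R]_d) (tau : R) :
  0 < tau -> \forall x \near y, enorm (x - y) < tau.
Proof.
move=> tau0.
have cont : (fun x : 'rV[R]_d => enorm (x - y)) x @[x --> y] --> enorm (y - y).
  apply: (@continuous_comp _ _ _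
    (fun x : 'rV[R]_d => \sum_(i < d) (x - y) 0 i ^+ 2) Num.sqrt);
    last exact: sqrt_continuous.
  rewrite /continuous_at.
  apply: (@cvg_big _ 'I_d +%R 0 xpredT _ _ (nbhs y)) => [|i _].
    exact: (@add_continuous R^o).
  apply: (@continuous_comp _ _ _
    (fun x : 'rV[R]_d => (x - y) 0 i) (fun t : R => t ^+ 2));
    last exact: exprn_continuous.
  apply: (@continuous_comp _ _ _ (fun x : 'rV[R]_d => x - y)
    (fun x : 'rV[R]_d => x 0 i)); last exact: coord_continuous.
  exact: (@cvgB _ _ _ (nbhs y) _ id (cst y) _ _ (fun A yA => yA)
    (@cvg_cst _ y _ (nbhs y) _)).
move/(@cvgr_lt _ _ _ _ _): cont; rewrite subrr enorm0; exact.
Qed.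

(** * Counting closer points *)

(** Turns a cardinality into the nonexistence of an injection, which passes to
    subsets. An infinite set satisfies neither side. *)
Lemma card_lt_II (T : Type) (k : nat) (S : set T) :
  (exists2 n, (n < k)%N & S #= `I_n) <-> ~ (`I_k #<= S).
Proof.
split=> [[n nk Sn] kS|kS].
  by move: kS; rewrite (card_le_eqr Sn) card_le_II leqNgt nk.
have [[n Sn]|Sinf] := pselect (finite_set S).
  exists n => //; rewrite ltnNge; apply/negP => kn; apply: kS.
  by rewrite (card_le_eqr Sn) card_le_II.
case: kS; apply: card_le_trans (subset_card_le _) _; last exact/infiniteP.
by [].
Qed.

Definition closer_indices (R : realType) (d : nat)
    (f : 'rV[int]_d -> 'rV[R]_d) (x : 'rV[R]_d) : set 'rV[int]_d :=
  [set a | a != 0 /\ enorm (x - f a) < enorm x].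

(** Injectivity lets the points of the range be counted by their indices; this
    puts two families indexed by the same lattice on an equal footing. *)
Lemma dom_rangeE (R : realType) (d k : nat) (f : 'rV[int]_d -> 'rV[R]_d)
    (x : 'rV[R]_d) : injective f -> f 0 = 0 ->
  dom k (range f) x <-> ~ (`I_k #<= closer_indices f x).
Proof.
move=> finj f0; rewrite /dom /= card_lt_II.
suff -> : [set a | (range f `\ 0) a /\ enorm (x - a) < enorm x]
    = f @` closer_indices f x.
  by rewrite (card_le_eqr (inj_card_eq _)) // => a b _ _; exact: finj.
apply/seteqP; split=> [_ [[[a _ <-] fa0] cl]|_ [a [a0 cl] <-]].
  by exists a => //; split=> //; apply: contra_notN fa0 => /eqP ->.
split=> //; split; first by exists a.
by rewrite /= -f0 => /finj /eqP; exact/negP.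
Qed.

(** * Stability along a ray *)

(** [s], [W] are the norms of a point and of its perturbation, [q], [Q] their
    products with the direction, [p], [P] their products with test points near
    the distances [m] and [l] on the ray. Everything is affine in [l], with
    positive slope, so that the worst case is [l = m + eps]. *)
Lemma closer_perturb_scalar (R : realType) (M eps tau m l s W q Q p P : R) :
  0 < M -> 0 < eps -> 0 < tau -> tau <= 8^-1 ->
  8 * M * tau * (14 * M + 2 * eps + 16) <= eps ->
  0 <= m -> m <= M -> m + eps <= l ->
  2^-1 <= s -> 0 <= W -> W <= s + tau ->
  s ^+ 2 < 2 * p -> p <= m * q + tau * s -> p <= (m + tau) * s ->
  q - tau <= Q -> l * Q - tau * W <= P ->
  W ^+ 2 < 2 * P.
Proof.
move=> M0 e0 t0 t8 small m0 mM ml s2 W0 Ws sp pq ps qQ QP.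
(* A point closer than [0] to [x] has norm at most twice that of [x]. *)
have s_le : s <= 2 * M + 2 * tau.
  have : s * s < (2 * (m + tau)) * s by rewrite -expr2; lra.
  by rewrite ltr_pM2r; lra.
have mq : s * (s - 2 * tau) <= 2 * (m * q) by nra.
have mq0 : 1 / 8 <= 2 * (m * q) by apply: le_trans mq; nra.
have q0 : 0 < q.
  by rewrite ltNge; apply/negP => q0; have := mulr_ge0_le0 m0 q0; lra.
(* Positive slope, with a lower bound that depends on M only. *)
have Mq : 1 / 8 <= 2 * (M * q).
  by apply: le_trans mq0 _; rewrite ler_pM2l // ler_pM2r.
have teps : 8 * M * (tau * (14 * M + 2 * eps + 16)) <= 8 * M * (2 * q * eps).
  have : 8^-1 * eps <= 2 * (M * q) * eps by rewrite ler_pM2r //; lra.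
  lra.
rewrite ler_pM2l in teps; last lra.
have tq : tau < q.
  have : 2 * tau * eps < 2 * q * eps.
    apply: lt_le_trans teps; rewrite -subr_gt0.
    have -> : tau * (14 * M + 2 * eps + 16) - 2 * tau * eps
      = tau * (14 * M + 16) by ring.
    by apply: mulr_gt0 => //; lra.
  by rewrite ltr_pM2r // ltr_pM2l.
have lQ : (m + eps) * (q - tau) <= l * Q.
  apply: (@le_trans _ _ (l * (q - tau))); first by rewrite ler_pM2r; lra.
  by rewrite ler_pM2l; lra.
have tm : tau * m <= tau * M by rewrite ler_pM2l.
have ts : tau * s <= tau * (2 * M + 2 * tau) by rewrite ler_pM2l.
have tW : tau * W <= tau * (s + tau) by rewrite ler_pM2l.
have tt : tau * tau <= tau * 8^-1 by rewrite ler_pM2l.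
have WW : W ^+ 2 <= (s + tau) ^+ 2 by rewrite ler_sqr ?nnegrE; lra.
apply: le_lt_trans WW _; nra.
Qed.

(** Being closer to [v] than to [0] is inherited at any distance at least
    [eps] farther out on the ray, even after moving the point [v] and both
    test points by [tau]. Allowing the test points to move is what lets the
    lemma be used at boundary points of a zone, which are only limits of
    points inside and outside. *)
Lemma closer_perturb (R : realType) (d : nat) (M eps tau m l : R)
    (u v w x y : 'rV[R]_d) :
  0 < M -> 0 < eps -> 0 < tau -> tau <= 8^-1 ->
  8 * M * tau * (14 * M + 2 * eps + 16) <= eps ->
  0 <= m -> m <= M -> m + eps <= l -> enorm u = 1 ->
  2^-1 <= enorm v -> enorm (v - w) <= tau ->
  enorm (x - m *: u) <= tau -> enorm (y - l *: u) <= tau ->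
  enorm (x - v) < enorm x -> enorm (y - w) < enorm y.
Proof.
move=> M0 e0 t0 t8 small m0 mM ml u1 v2 vw xm yl.
rewrite !closer_dot -!sqr_enorm => xv.
have wv : enorm (w - v) <= tau by rewrite -opprB enormN.
have Ws : enorm w <= enorm v + tau.
  by rewrite -[w in enorm w](subrK v) addrC;
    apply: le_trans (ler_enormD _ _) _; rewrite lerD2l.
have xE : dot x v = m * dot u v + dot (x - m *: u) v.
  by rewrite dotBl dotZl; ring.
have yE : dot y w = l * dot u w + dot (y - l *: u) w.
  by rewrite dotBl dotZl; ring.
have uE : dot u w = dot u v + dot u (w - v) by rewrite dotBr; ring.
have xn : enorm x <= m + tau.
  rewrite -(subrK (m *: u) x); apply: le_trans (ler_enormD _ _) _.
  by rewrite enormZ // u1 mulr1 addrC lerD2l.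
apply: (@closer_perturb_scalar _ M eps tau m l (enorm v) (enorm w)
  (dot u v) (dot u w) (dot x v) (dot y w)) => //; rewrite ?enorm_ge0 //.
- rewrite xE lerD2l; apply: le_trans (dot_le _ _) _.
  by rewrite ler_wpM2r ?enorm_ge0.
- by apply: le_trans (dot_le _ _) _; rewrite ler_wpM2r ?enorm_ge0.
- rewrite uE lerD2l; apply: le_trans _ (dot_ge _ _).
  by rewrite u1 mul1r lerN2.
- rewrite yE lerD2l; apply: le_trans _ (dot_ge _ _).
  by rewrite lerN2 ler_wpM2r ?enorm_ge0.
Qed.

Lemma dom_perturb (R : realType) (d k : nat) (M eps tau m l : R)
    (f g : 'rV[int]_d -> 'rV[R]_d) (u x y : 'rV[R]_d) :
  injective f -> f 0 = 0 -> injective g -> g 0 = 0 ->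
  (forall a, a != 0 -> 2^-1 <= enorm (f a)) ->
  (forall a, enorm (f a - g a) <= tau) ->
  0 < M -> 0 < eps -> 0 < tau -> tau <= 8^-1 ->
  8 * M * tau * (14 * M + 2 * eps + 16) <= eps ->
  0 <= m -> m <= M -> m + eps <= l -> enorm u = 1 ->
  enorm (x - m *: u) <= tau -> enorm (y - l *: u) <= tau ->
  dom k (range g) y -> dom k (range f) x.
Proof.
move=> finj f0 ginj g0 f2 fg M0 e0 t0 t8 small m0 mM ml u1 xm yl.
move/(dom_rangeE _ _ ginj g0) => gy; apply/(dom_rangeE _ _ finj f0) => fx.
apply: gy; apply: card_le_trans fx (subset_card_le _) => a [a0 xa].
split=> //.
by apply: (@closer_perturb _ _ M eps tau m l u (f a) (g a) x y) => //;
  exact: f2.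
Qed.

(** * Boundary points on a ray *)

(** The supremum of the distances in [D] works: just beyond it the ray has
    left [D]. *)
Lemma boundary_on_ray (R : realType) (d : nat) (D : set 'rV[R]_d)
    (u : 'rV[R]_d) (L : R) :
  D 0 -> (forall l, L <= l -> ~ D (l *: u)) ->
  exists l, 0 <= l /\ boundary D (l *: u).
Proof.
move=> D0 DL; pose E := [set l : R | 0 <= l /\ D (l *: u)].
have E0 : E 0 by split=> //; rewrite scale0r.
have ubE : has_ubound E.
  exists L => l [_ Dl]; rewrite leNgt; apply/negP => /ltW /DL; exact.
have supE : has_sup E by split=> //; exists 0.
have s0 : 0 <= sup E by exact: ub_le_sup.
have near_ray B : nbhs (sup E *: u) B ->
    exists2 r : R, 0 < r & forall l, `|sup E - l| < r -> B (l *: u).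
  move=> /(@scalel_continuous _ _ u (sup E)) /nbhs_ballP [r r0 rB].
  by exists r => // l lr; exact: rB.
exists (sup E); split=> //; split=> [B /near_ray [r r0 rB]|/near_ray [r r0 rB]].
  have [l El lr] := sup_adherent r0 supE.
  exists (l *: u); split; first by case: El.
  by apply: rB; rewrite ger0_norm ?subr_ge0 ?(ub_le_sup ubE) //; lra.
have : E (sup E + r / 2).
  split; first by lra.
  by apply: rB; rewrite opprD addNKr normrN ger0_norm; lra.
by move/(ub_le_sup ubE); rewrite gerDl leNgt divr_gt0.
Qed.

Lemma boundary_approx (R : realType) (d : nat) (D : set 'rV[R]_d)
    (z : 'rV[R]_d) (tau : R) : 0 < tau -> boundary D z ->
  (exists2 x, enorm (x - z) <= tau & D x) /\
  (exists2 x, enorm (x - z) <= tau & ~ D x).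
Proof.
move=> t0 [clD intD]; have zt := enorm_dist_continuous z t0; split.
  by have [x [Dx xz]] := clD _ zt; exists x => //; exact: ltW.
apply: contrapT => H; apply: intD; apply: filterS zt => x xz.
by apply: contrapT => Dx; apply: H; exists x => //; exact: ltW.
Qed.

(** * The integer lattice *)

Lemma int_vec_inj (R : realType) (d : nat) : injective (@int_vec R d).
Proof.
move=> a b /matrixP ab; apply/matrixP => i j.
by have := ab i j; rewrite !mxE; exact: intr_inj.
Qed.

Lemma int_vec0 (R : realType) (d : nat) : @int_vec R d 0 = 0.
Proof. by apply/rowP => i; rewrite !mxE. Qed.

Lemma enorm_int_vec_ge1 (R : realType) (d : nat) (a : 'rV[int]_d) :
  a != 0 -> 1 <= enorm (int_vec R a).
Proof.
move=> /rV0Pn [i ai]; rewrite enormE -[leLHS]sqrtr1 ler_wsqrtr //.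
rewrite /dot (bigD1 i) //= -[leLHS]addr0 lerD //; last first.
  by apply: sumr_ge0 => j _; rewrite -expr2 sqr_ge0.
rewrite !mxE -expr2 -real_normK ?num_real // -intr_norm.
by rewrite exprn_ege1 // ler1z -gtz0_ge1 normr_gt0.
Qed.

Lemma unit_large_coord (R : realType) (d : nat) (u : 'rV[R]_d) :
  (1 <= d)%N -> enorm u = 1 -> exists i, d%:R^-1 <= `|u 0 i|.
Proof.
move=> d1 u1; apply: contrapT => H.
have d0 : 0 < d%:R :> R by rewrite ltr0n.
have ui i : `|u 0 i| < d%:R^-1.
  by rewrite ltNge; apply/negP => ui; apply: H; exists i.
have : dot u u < 1; last by rewrite -sqr_enorm u1 expr1n ltxx.
have -> : 1 = \sum_(i < d) (d%:R^-1 : R).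
  by rewrite sumr_const card_ord -[_ *+ _]mulr_natl mulfV // gt_eqF.
apply: ltr_sum; first by apply/hasP;
  exists (Ordinal d1) => //; exact: mem_index_enum.
move=> i _; rewrite -expr2 -real_normK ?num_real //.
apply: le_lt_trans (ui i); rewrite expr2 ler_piMr //.
by apply: le_trans (ltW (ui i)) _; rewrite invf_le1 // ler1n.
Qed.

(** If [u] has a coordinate of absolute value at least [1/d], then the
    multiples [1, ..., k] of the corresponding signed basis vector are all
    closer to [k d u] than [0] is. *)
Lemma card_closer_lattice (R : realType) (d k : nat) (u : 'rV[R]_d) :
  (1 <= d)%N -> enorm u = 1 ->
  `I_k #<= closer_indices (@int_vec R d) ((k * d)%:R *: u).
Proof.
move=> d1 u1; have [i ui] := unit_large_coord d1 u1.
have d0 : 0 < d%:R :> R by rewrite ltr0n.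
pose sg : int := if 0 <= u 0 i then 1 else -1.
have sg2 : (sg%:~R : R) * sg%:~R = 1.
  by rewrite /sg; case: ifP => _; rewrite ?mulrNN mulr1.
have sgu : sg%:~R * u 0 i = `|u 0 i|.
  rewrite /sg; case: ifPn => [u0|]; first by rewrite mul1r ger0_norm.
  by rewrite -ltNge => u0; rewrite ltr0_norm // mulN1r.
pose a (j : nat) : 'rV[int]_d := (sg * j.+1%:Z) *: delta_mx 0 i.
have ai j : (a j) 0 i = sg * j.+1%:Z by rewrite !mxE !eqxx mulr1.
have dotZ (x : 'rV[R]_d) j : dot x (int_vec R (a j))
    = sg%:~R * j.+1%:R * x 0 i.
  rewrite /dot (bigD1 i) //= big1 ?addr0.
    by rewrite mxE ai intrM mulrC.
  by move=> h hi; rewrite !mxE (negPf hi) andbF mulr0 mulr0.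
have sg0 : sg != 0 by rewrite /sg; case: ifP.
have a_inj : {in `I_k &, injective a}.
  move=> j h _ _ jh; have := ai j; rewrite jh ai => /(mulfI sg0).
  by case.
rewrite -(card_le_eql (inj_card_eq a_inj)); apply: subset_card_le.
move=> _ [j jk <-]; split.
  apply/eqP => aj; have := ai j; rewrite aj mxE => /esym/eqP.
  by rewrite mulf_eq0 (negPf sg0).
rewrite closer_dot dotZl !dotZ mxE ai intrM.
have -> : (sg%:~R * j.+1%:R * (sg%:~R * j.+1%:~R) : R) = j.+1%:R * j.+1%:R.
  by rewrite mulrACA sg2 mul1r.
have -> : 2 * ((k * d)%:R * (sg%:~R * j.+1%:R * u 0 i))
    = j.+1%:R * (2 * k%:R * (d%:R * `|u 0 i|)) :> R.
  by rewrite -sgu natrM; ring.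
rewrite ltr_pM2l ?ltr0n //.
have du : 1 <= d%:R * `|u 0 i|.
  by rewrite -[leLHS](mulfV (lt0r_neq0 d0)) ler_pM2l.
have jk' : j.+1%:R <= k%:R :> R by rewrite ler_nat.
have k0 : 0 < k%:R :> R by apply: lt_le_trans jk'; rewrite ltr0n.
have : 2 * k%:R * 1 <= 2 * k%:R * (d%:R * `|u 0 i|) by rewrite ler_pM2l //; lra.
lra.
Qed.

(** * Comparison of the boundary distances *)

Theorem theorem4p3 (R : realType) (d : nat) (d_ge1 : (1 <= d)%N) :
  forall (k : nat) (eps : R), (1 <= k)%N -> 0 < eps ->
  exists2 tau : R, 0 < tau &
    forall phi : 'rV[int]_d -> 'rV[R]_d,
      injective phi -> phi 0 = 0 ->
      (ereal_sup (range (fun a => (enorm (int_vec R a - phi a))%:E))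
         < tau%:E)%E ->
      forall u : 'rV[R]_d, unit_sphere R d u ->
        `|beta k phi u - alpha k u| < eps.
Proof.
move=> k eps k1 e0.
(* [k d] bounds the distances for the lattice, and [eps] leaves room for the
   perturbed set, so that [M] bounds the distances for both. *)
pose M0 : R := (k * d)%:R.
have M00 : 0 < M0 by rewrite ltr0n muln_gt0 k1.
pose M := M0 + eps.
have M_gt0 : 0 < M by rewrite addr_gt0.
have C0 : 0 < 8 * M * (14 * M + 2 * eps + 16) by rewrite mulr_gt0 //; lra.
pose tau := Num.min 8^-1 (eps / (8 * M * (14 * M + 2 * eps + 16))).
have t0 : 0 < tau by rewrite lt_min invr_gt0 ltr0n divr_gt0.
have t8 : tau <= 8^-1 by rewrite ge_min lexx.
have small : 8 * M * tau * (14 * M + 2 * eps + 16) <= eps.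
  by rewrite mulrAC [leLHS]mulrC -ler_pdivlMr // ge_min lexx orbT.
exists tau => // phi phi_inj phi0 sup_lt u u1.
have iphi a : enorm (int_vec R a - phi a) <= tau.
  rewrite -lee_fin; apply: le_trans (ltW sup_lt).
  by apply: ereal_sup_ubound; exists a.
have phii a : enorm (phi a - int_vec R a) <= tau by rewrite -opprB enormN.
have ii (a : 'rV[int]_d) : enorm (int_vec R a - int_vec R a) <= tau.
  by rewrite subrr enorm0 ltW.
have i2 (a : 'rV[int]_d) : a != 0 -> 2^-1 <= enorm (int_vec R a).
  by move/(enorm_int_vec_ge1 R) => h; lra.
have phi2 (a : 'rV[int]_d) : a != 0 -> 2^-1 <= enorm (phi a).
  move/(enorm_int_vec_ge1 R) => h.
  have := ler_enormD (int_vec R a - phi a) (phi a); rewrite subrK.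
  by have := iphi a; lra.
have Z_inj := @int_vec_inj R d.
have Z0 := int_vec0 R d.
have far : ~ dom k (range (@int_vec R d)) (M0 *: u).
  by move/(dom_rangeE _ _ Z_inj Z0); apply; exact: card_closer_lattice.
have dom0 (f : 'rV[int]_d -> 'rV[R]_d) :
    injective f -> f 0 = 0 -> dom k (range f) (0 : 'rV[R]_d).
  move=> finj f0; apply/(dom_rangeE _ _ finj f0).
  have -> : closer_indices f 0 = set0.
    by apply/seteqP; split=> // a [_]; rewrite enorm0 ltNge enorm_ge0.
  by move=> /card_le0P Ik; have : `I_k 0%N := k1; rewrite Ik.
have beyond (f : 'rV[int]_d -> 'rV[R]_d) l y : injective f -> f 0 = 0 ->
    (forall a, enorm (int_vec R a - f a) <= tau) ->
    M <= l -> enorm (y - l *: u) <= tau -> ~ dom k (range f) y.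
  move=> finj f0 fi Ml yl fy; apply: far.
  apply: (@dom_perturb _ _ _ M eps tau M0 l _ f u _ y) => //.
  - by rewrite lerDl ltW.
  - by rewrite subrr enorm0 ltW.
have dist (f : 'rV[int]_d -> 'rV[R]_d) : injective f -> f 0 = 0 ->
    (forall a, enorm (int_vec R a - f a) <= tau) ->
    0 <= bd_dist k (range f) u /\
    boundary (dom k (range f)) (bd_dist k (range f) u *: u).
  move=> finj f0 fi; apply: (@getPex _
    [set l : R | 0 <= l /\ boundary _ (l *: u)]).
  apply: (@boundary_on_ray _ _ _ _ M); first exact: dom0.
  by move=> l Ml; apply: (beyond f l) => //; rewrite subrr enorm0 ltW.
have [a0 bda] := dist _ Z_inj Z0 ii.
have [b0 bdb] := dist _ phi_inj phi0 iphi.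
rewrite -/(alpha k u) in a0 bda; rewrite -/(beta k phi u) in b0 bdb.
have [[xa xa_n xa_in] [ya ya_n ya_out]] := boundary_approx t0 bda.
have [[xb xb_n xb_in] [yb yb_n yb_out]] := boundary_approx t0 bdb.
have alphaM : alpha k u <= M.
  rewrite leNgt; apply/negP => /ltW Ma.
  exact: (beyond _ _ xa Z_inj Z0 ii Ma xa_n).
move: (alpha k u) (beta k phi u) a0 b0 xa_n ya_n xb_n yb_n alphaM
  => a b a0 b0 xa_n ya_n xb_n yb_n aM.
rewrite ltr_distl; apply/andP; split; rewrite ltNge; apply/negP => ba.
  apply: yb_out; apply: (@dom_perturb _ _ _ M eps tau b a
    phi (@int_vec R d) u yb xa) => //; lra.
by apply: ya_out; apply: (@dom_perturb _ _ _ M eps tau a b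
    (@int_vec R d) phi u ya xb).
Qed.
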